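(* Let $2\le k\le n$, $\Omega\subset\mathbb R^n$ bounded, $A$ symmetric, $B$ skew-symmetric bounded, $f$ continuous on $\mathcal D=\overline\Omega\times\mathbb R\times\mathbb R^n$, and $0<\delta<1$. Suppose there exists $u\in C^2(\overline\Omega)$ solving $S_k(D^2u-A(x,u,Du)-B(x,u,Du))=f(x,u,Du)$ in $\overline\Omega$ such that (i) $\lambda_u>0$, (ii) $\mu(B)\le\delta\lambda_u$, (iii) $\sup_{\overline\Omega}|u|\le M_0$, $\sup_{\overline\Omega}|Du|\le M_1$. Then necessarily $$\mu(B)\le\delta\Big[\frac{f_1}{\binom nk}\Big]^{1/k},\qquad f_1=\sup_{x\in\overline\Omega,\ |z|\le M_0,\ |p|\le M_1}f(x,z,p).$$
   Context: For $R\in\mathbb{R}^{n\times n}$, $S_k(R)=\sigma_k(\lambda(R))$, where $\lambda(R)\in\mathbb{C}^n$ are the eigenvalues of $R$ and $\sigma_k(\lambda)=\sum_{1\le i_1<\dots<i_k\le n}\lambda_{i_1}\cdots\lambda_{i_k}$. For $u\in C^2(\overline\Omega)$: $\omega(x,u)=D^2u-A(x,u,Du)$, $\lambda_u=\inf_{\overline\Omega}\lambda_{\min}(\omega(x,u))$; $\mu(B)=\sup_{\mathcal D}\|B(x,z,p)\|$ (operator norm). *)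

(* Defs.v *)
From mathcomp Require Import all_boot all_order all_algebra.
From mathcomp Require Import all_classical all_reals all_analysis.
From mathcomp Require Import complex.
Import Order.TTheory GRing.Theory Num.Theory.
Import numFieldNormedType.Exports.

Set Implicit Arguments.
Unset Strict Implicit.
Unset Printing Implicit Defensive.

Local Open Scope ring_scope.
Local Open Scope classical_set_scope.

Definition sigma_k (F : comRingType) (n k : nat) (lam : 'I_n -> F) : F :=
  \sum_(s : {set 'I_n} | #|s| == k) \prod_(i in s) lam i.

Definition is_spectrum (R : realType) (n : nat) (M : 'M[R]_n)
    (lam : {ffun 'I_n -> R[i]}) : Prop :=
  char_poly (map_mx (fun r : R => (r%:C)%C) M) = \prod_(i < n) ('X - (lam i)%:P).

(* a chosen eigenvalue vector lambda(M) in C^n (exists since C is algebraically closed) *)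
Definition eigs (R : realType) (n : nat) (M : 'M[R]_n) : {ffun 'I_n -> R[i]} :=
  xget [ffun => 0] (is_spectrum M).

Definition S_k (R : realType) (n k : nat) (M : 'M[R]_n) : R[i] :=
  sigma_k k (eigs M).

(* smallest eigenvalue (used for symmetric matrices, whose eigenvalues are real) *)
Definition lambda_min (R : realType) (n : nat) (M : 'M[R]_n) : R :=
  inf (range (fun i : 'I_n => complex.Re (eigs M i))).

Definition enorm (R : realType) (n : nat) (v : 'rV[R]_n) : R :=
  Num.sqrt (\sum_(i < n) v ord0 i ^+ 2).

(* operator norm of M acting on column vectors: sup_{|v|=1} |M v| *)
Definition opnorm (R : realType) (n : nat) (M : 'M[R]_n) : R :=
  sup [set enorm (v *m M^T) | v in [set v : 'rV[R]_n | enorm v = 1]].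

Definition inD (R : realType) (n : nat) (Om : set 'rV[R]_n)
    (x : 'rV[R]_n) (z : R) (p : 'rV[R]_n) : Prop := closure Om x.

Definition mu (R : realType) (n : nat) (Om : set 'rV[R]_n)
    (B : 'rV[R]_n -> R -> 'rV[R]_n -> 'M[R]_n) : R :=
  sup [set opnorm (B q.1.1 q.1.2 q.2) |
        q in [set q : 'rV[R]_n * R * 'rV[R]_n | inD Om q.1.1 q.1.2 q.2]].

Definition lambda_u (R : realType) (n : nat) (Om : set 'rV[R]_n)
    (A : 'rV[R]_n -> R -> 'rV[R]_n -> 'M[R]_n)
    (u : 'rV[R]_n -> R) (Du : 'rV[R]_n -> 'rV[R]_n) (D2u : 'rV[R]_n -> 'M[R]_n) : R :=
  inf [set lambda_min (D2u x - A x (u x) (Du x)) | x in closure Om].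

(* u in C^2(closure Omega), with gradient Du and Hessian D2u:
   first and second partial derivatives exist in (open) Omega and
   u, Du, D2u extend continuously to closure(Omega). *)
Definition C2_closure (R : realType) (n : nat) (Om : set 'rV[R]_n)
    (u : 'rV[R]_n -> R) (Du : 'rV[R]_n -> 'rV[R]_n) (D2u : 'rV[R]_n -> 'M[R]_n) : Prop :=
  [/\ forall x, Om x -> forall i : 'I_n,
        is_derive x (delta_mx ord0 i : 'rV[R]_n) u (Du x ord0 i),
      forall x, Om x -> forall i j : 'I_n,
        is_derive x (delta_mx ord0 j : 'rV[R]_n) (fun y => Du y ord0 i) (D2u x i j),
      {within closure Om, continuous u},
      {within closure Om, continuous Du} &
      {within closure Om, continuous D2u}].

Definition f1 (R : realType) (n : nat) (Om : set 'rV[R]_n)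
    (f : 'rV[R]_n -> R -> 'rV[R]_n -> R) (M0 M1 : R) : R :=
  sup [set f q.1.1 q.1.2 q.2 |
        q in [set q : 'rV[R]_n * R * 'rV[R]_n |
               [/\ closure Om q.1.1, `|q.1.2| <= M0 & enorm q.2 <= M1]]].

(* Main.v *)
(* Only one point x0 of Om matters. Put S = D^2u - A and K = B at x0, so that S is
   symmetric (equality of mixed derivatives) with spectrum >= a := lambda_u, and K is
   skew. If v is an eigenvector of S - K for z, then Re z |v|^2 = v S v^* because
   v K v^* is purely imaginary, hence Re z >= a. The eigenvalues of S - K form a
   conjugation-invariant multiset, so pairing z with its conjugate gives
   prod (X + z_i) >= (X + a)^n coefficientwise: real factors are X + z >= X + a, and
   conjugate pairs are X^2 + 2 Re z X + |z|^2 >= (X + a)^2. Comparing coefficients,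
   binom(n, k) a^k <= S_k(S - K) = f <= f1, and f1 is a genuine supremum since f is
   continuous on a compact set. *)
Require Import Defs.
From mathcomp Require Import all_boot all_order all_algebra.
From mathcomp Require Import all_classical all_reals all_analysis.
From mathcomp Require Import complex.
From mathcomp Require Import ring.
Import Order.TTheory GRing.Theory Num.Theory.
Import numFieldNormedType.Exports.
Local Open Scope ring_scope.
Local Open Scope classical_set_scope.
Local Open Scope sesquilinear_scope.

(** * Elementary symmetric functions and coefficientwise comparison of polynomials *)

Lemma coef_prod_XaddC (F : comNzRingType) (n k : nat) (lam : 'I_n -> F) :
  (k <= n)%N ->
  (\prod_(i < n) ('X + (lam i)%:P))`_(n - k) = sigma_k k lam.
Proof.
move=> kn; under eq_bigr do rewrite addrC.
(* Expanding the product, [J] collects the factors that contribute [lam i]; the others contribute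
   ['X], so [J] lives in degree [n - #|J|]. *)
rewrite bigA_distr coef_sum /sigma_k [RHS]big_mkcond /=.
apply: eq_bigr => J _.
rewrite (bigID (fun i => i \in J)) /=.
rewrite (eq_bigr (fun i => (lam i)%:P)); last by move=> i ->.
rewrite [X in _ * X](eq_bigr (fun=> 'X)); last by move=> i /negPf ->.
rewrite -rmorph_prod /= prodr_const coefCM coefXn.
have Jn : (#|J| <= n)%N by rewrite -[X in (_ <= X)%N]card_ord max_card.
have -> : #|[predC J]| = (n - #|J|)%N.
  by apply/esym/eqP; rewrite -(eqn_add2l #|J|) subnKC // -[X in X == _]card_ord
             -(cardC (mem J)).
(* [n - k = n - #|J|] forces [k = #|J|] because both are at most [n]; truncated subtraction would
   otherwise lose this. *)
by rewrite eqn_sub2lE // eq_sym; case: eqP => _; rewrite ?mulr1 ?mulr0.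
Qed.

Lemma ler_coefM (F : numDomainType) (p q p' q' : {poly F}) :
  (forall i, 0 <= p`_i <= p'`_i) -> (forall i, 0 <= q`_i <= q'`_i) ->
  forall i, 0 <= (p * q)`_i <= (p' * q')`_i.
Proof.
move=> hp hq i; rewrite !coefM; apply/andP; split.
  by apply: sumr_ge0 => j _; apply: mulr_ge0;
     [case/andP: (hp j)|case/andP: (hq (i - j)%N)].
by apply: ler_sum => j _; case/andP: (hp j) => ? ?;
   case/andP: (hq (i - j)%N) => ? ?; apply: ler_pM.
Qed.

(** Strong induction on the length: a real head is removed alone, a nonreal head together with its
    conjugate. Closure under conjugation is phrased with [perm_eq] so that multiplicities survive
    the removal. *)
Lemma conj_closed_coef_ge (C : numClosedFieldType) (s : seq C) (a : C) :
  0 <= a -> perm_eq [seq z^* | z <- s]%R s ->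
  (forall z, z \in s -> a <= 'Re z) ->
  forall i, 0 <= (('X + a%:P) ^+ size s)`_i <= (\prod_(z <- s) ('X + z%:P))`_i.
Proof.
move=> a0; have [m] := ubnP (size s); elim: m s => // m IH [|z t] /= sm cs ha i.
  by rewrite big_nil expr0 coef1 lexx ler0n.
have az : a <= 'Re z by apply: ha; rewrite mem_head.
have [zr|znr] := eqVneq (z^*)%R z.
  rewrite exprS big_cons; apply: ler_coefM i => i.
    have zE : 'Re z = z by apply/Creal_ReP/CrealP.
    rewrite !coefD !coefX !coefC; apply/andP; split.
      by apply: addr_ge0; [exact: ler0n|case: ifP].
    by rewrite lerD2l; case: ifP => // _; rewrite -zE.
  apply: IH => //; first by move: cs; rewrite zr perm_cons.
  by move=> w wt; apply: ha; rewrite in_cons wt orbT.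
have zt : (z^*)%R \in t.
  have : (z^*)%R \in z :: t by rewrite -(perm_mem cs) mem_head.
  by rewrite in_cons (negPf znr).
have pt := perm_to_rem zt; set t' := rem _ t in pt.
have st : size t = (size t').+1 by rewrite (perm_size pt).
rewrite big_cons (perm_big _ pt) /= big_cons mulrA st !exprS mulrA.
apply: ler_coefM i => i.
  have -> : ('X + z%:P) * ('X + (z^*)%R%:P) =
            'X^2 + ('Re z *+ 2)%:P * 'X + ((`|z| ^+ 2))%:P.
    have -> : 'Re z *+ 2 = z + (z^*)%R.
      by rewrite [in RHS](Crect z) conjC_rect ?Creal_Re ?Creal_Im // addrACA addrN addr0 mulr2n.
    by rewrite normCK polyCM polyCD; ring.
  have -> : ('X + a%:P) * ('X + a%:P) = 'X^2 + (a *+ 2)%:P * 'X + (a ^+ 2)%:P.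
    by rewrite polyCMn [a ^+ 2]expr2 polyCM; ring.
  rewrite !coefD !coefCM !coefXn !coefX !coefC; apply/andP; split.
    apply: addr_ge0; last by case: ifP => // _; apply: exprn_ge0.
    by apply: addr_ge0; rewrite ?ler0n // mulr_ge0 ?mulrn_wge0.
  apply: lerD.
    by rewrite lerD2l ler_wpM2r // lerMn2r az orbT.
  (* Constant term: the squared modulus is the sum of the squares of the real and imaginary parts,
     hence at least [a ^+ 2 + 0]. *)
  case: ifP => // _; rewrite normC2_Re_Im.
  have Rz0 := le_trans a0 az.
  by rewrite -[a ^+ 2]addr0 lerD ?lerXn2r ?nnegrE // -realEsqr Creal_Im.
apply: IH => //; first by move: sm; rewrite st => /ltnW.
(* Conjugation swaps [z] and its conjugate, so the pair cancels on both sides and [t'] is again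
   closed under conjugation. *)
- have pz : perm_eq [:: z^*, z & [seq w^* | w <- t']]%R [:: z, z^* & t']%R.
    have p1 : perm_eq [:: z^*, z & [seq w^* | w <- t']]%R
                      [seq w^* | w <- z :: t]%R.
      by rewrite /= perm_cons -[X in X :: _]conjCK -map_cons perm_sym; exact: perm_map.
    apply: (perm_trans p1); apply: (perm_trans cs).
    by rewrite perm_cons.
  by move: pz; rewrite (perm_catCA [:: z^*]%R [:: z] _) !perm_cons.
- by move=> w wt; apply: ha; rewrite in_cons (perm_mem pt) in_cons wt !orbT.
Qed.

(** * Hermitian forms and eigenvalues of skew perturbations *)

Lemma eigenvalue_invmx_diag (F : fieldType) (n : nat) (P : 'M[F]_n)
    (d : 'rV[F]_n) (j : 'I_n) :
  P \in unitmx -> eigenvalue (invmx P *m diag_mx d *m P) (d ord0 j).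
Proof.
(* Eigenvectors are row vectors here, so rows of [P] serve; a zero row would contradict
   invertibility. *)
move=> Pu; apply/eigenvalueP; exists (row j P).
  rewrite -row_mul !mulmxA mulmxV // mul1mx row_mul row_diag_mx.
  by rewrite -scalemxAl -rowE.
apply: contraTneq Pu => Pj0; rewrite -row_free_unit; apply/negP => /row_freeP[Q].
move=> /(congr1 (row j)); rewrite row_mul Pj0 mul0mx => /rowP /(_ j).
by rewrite !mxE eqxx => /eqP; rewrite eq_sym oner_eq0.
Qed.

(** Unitary diagonalisation and the substitution [w = v *m P ^t*] turn the two sides into the sums
    of [a |w_j|^2] and of [d_j |w_j|^2]. *)
Lemma hermsymmx_form_ge (C : numClosedFieldType) (n : nat) (S : 'M[C]_n) (a : C) :
  S \is hermsymmx -> (forall z, eigenvalue S z -> a <= z) ->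
  forall v : 'rV[C]_n, a * (v *m v ^t*) 0 0 <= (v *m S *m v ^t*) 0 0.
Proof.
move=> hS ha v; have /hermitian_normalmx /orthomx_spectralP := hS.
set P := spectralmx S; set d := spectral_diag S => SE.
have Pu : P \in unitmx := spectral_unit S.
have PV : invmx P = P ^t* := invmx_unitary (spectral_unitarymx S).
have da j : a <= d ord0 j by apply: ha; rewrite SE; exact: eigenvalue_invmx_diag.
pose w := v *m P ^t*.
have wE : w ^t* = P *m v ^t* by rewrite /w trmx_mul map_mxM trmxCK.
have -> : v *m v ^t* = w *m w ^t*.
  by rewrite wE /w mulmxA -PV mulmxKV.
have -> : v *m S *m v ^t* = w *m diag_mx d *m w ^t*.
  by rewrite wE SE PV /w !mulmxA.
rewrite !mxE mulr_sumr; apply: ler_sum => j _.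
rewrite mul_mx_diag !mxE mulrAC -normCK mulrC.
by rewrite ler_wpM2l ?exprn_ge0.
Qed.

Lemma mulmx_trC_gt0 (C : numClosedFieldType) (n : nat) (v : 'rV[C]_n) :
  v != 0 -> 0 < (v *m v ^t*) 0 0.
Proof.
move=> v0; have [j vj] : exists j, v ord0 j != 0.
  apply/existsP; apply: contraNT v0 => /existsPn v0; apply/eqP/rowP => j.
  by rewrite mxE; apply/eqP/negbNE/v0.
rewrite mxE (bigD1 j) //= ltr_wpDr //.
  by apply: sumr_ge0 => i _; rewrite !mxE -normCK exprn_ge0.
by rewrite !mxE -normCK exprn_gt0 // normr_gt0.
Qed.

Lemma hermsymmx_trC (C : numClosedFieldType) (n : nat) (S : 'M[C]_n) :
  S \is hermsymmx -> S ^t* = S.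
Proof. by move=> /is_hermitianmxP; rewrite expr0 scale1r => <-. Qed.

(** The eigenvalue is a Rayleigh quotient of two self-conjugate numbers. The order on [C] only
    relates numbers with equal imaginary parts, so realness is what turns a bound on real parts into
    one on eigenvalues. *)
Lemma hermsymmx_eigenvalue_real (C : numClosedFieldType) (n : nat) (S : 'M[C]_n) (z : C) :
  S \is hermsymmx -> eigenvalue S z -> z \is Num.real.
Proof.
move=> hS /eigenvalueP[v vz v0]; have N0 := @mulmx_trC_gt0 _ _ _ v0.
have zN : z * (v *m v ^t*) 0 0 = (v *m S *m v ^t*) 0 0 by rewrite vz -scalemxAl [RHS]mxE.
have -> : z = (v *m S *m v ^t*) 0 0 / (v *m v ^t*) 0 0 by rewrite -zN mulfK // gt_eqF.
rewrite rpred_div ?(gtr0_real N0) //; apply/CrealP.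
transitivity (((v *m S *m v ^t*) ^t*) 0 0); first by rewrite [RHS]mxE [in RHS]mxE.
by rewrite !trmx_mul !map_mxM /= trmxCK hermsymmx_trC // mulmxA.
Qed.

(** Conjugation flips the sign of the form of [K] and fixes that of [S]; adding the equation for
    [z * N] to its conjugate therefore eliminates [K]. *)
Lemma eigenvalue_sub_skew_Re_ge (C : numClosedFieldType) (n : nat)
    (S K : 'M[C]_n) (a z : C) :
  S \is hermsymmx -> K ^t* = - K -> (forall z, eigenvalue S z -> a <= z) ->
  eigenvalue (S - K) z -> a <= 'Re z.
Proof.
move=> hS hK ha /eigenvalueP[v vz v0].
have := @hermsymmx_form_ge _ _ _ _ hS ha v.
have S_herm := @hermsymmx_trC _ _ _ hS.
pose N := (v *m v ^t*) 0 0; pose s := (v *m S *m v ^t*) 0 0.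
have N0 : 0 < N by exact: mulmx_trC_gt0.
have adj (x : 'M[C]_1) : ((x 0 0)^*)%R = (x ^t*) 0 0 by rewrite !mxE.
have Nr : (N^*)%R = N by apply/CrealP; exact: gtr0_real.
have zN : z * N = s - (v *m K *m v ^t*) 0 0.
  have <- : (v *m (S - K) *m v ^t*) 0 0 = z * N by rewrite vz -scalemxAl mxE.
  by rewrite mulmxBr mulmxBl [LHS]mxE [X in _ + X]mxE.
have zNc : (z^*)%R * N = s + (v *m K *m v ^t*) 0 0.
  rewrite -{1}Nr -rmorphM zN rmorphB /= !adj.
  rewrite !trmx_mul !map_mxM /= trmxCK S_herm hK mulNmx mulmxN !mulmxA.
  by rewrite [X in _ - X]mxE opprK.
have ReN : 'Re z * N = s.
  apply: (@mulfI _ 2); first by rewrite pnatr_eq0.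
  have -> : 2 * ('Re z * N) = z * N + (z^*)%R * N.
    by rewrite -mulrDl [z in z + _](Crect z) [z in _ + z^*](Crect z)
       conjC_rect ?Creal_Re ?Creal_Im //; ring.
  by rewrite zN zNc; ring.
by rewrite -/N -/s -ReN ler_pM2r.
Qed.

(** * Spectra of real matrices and the lower bound for [S_k] *)

Lemma eigs_spectrum (R : realType) (n : nat) (M : 'M[R]_n) :
  is_spectrum M (eigs M).
Proof.
(* [xget] falls back on the zero vector unless a spectrum exists; one is obtained by splitting the
   monic characteristic polynomial over [R[i]]. *)
apply: xgetPex.
set p := char_poly (map_mx (fun r : R => (r%:C)%C) M).
have [s ps] := closed_field_poly_normal p.
have lp : lead_coef p = 1 by apply/monicP; exact: char_poly_monic.
rewrite lp scale1r in ps.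
have ss : size s = n.
  by apply: succn_inj; rewrite -(size_prod_XsubC s id) -ps size_char_poly.
exists [ffun i : 'I_n => s`_i]; rewrite /is_spectrum -/p ps.
rewrite (big_nth 0) ss big_mkord; apply: eq_bigr => i _.
by rewrite ffunE.
Qed.

Lemma eigenvalue_eigsP (R : realType) (n : nat) (M : 'M[R]_n) (z : R[i]) :
  eigenvalue (map_mx (fun r : R => (r%:C)%C) M) z <-> exists i, z = eigs M i.
Proof.
rewrite eigenvalue_root_char eigs_spectrum -(big_map (eigs M) xpredT (fun x => 'X - x%:P)).
rewrite root_prod_XsubC; split => [/mapP[i _ ->]|[i ->]]; first by exists i.
by apply: map_f; rewrite mem_index_enum.
Qed.

(** The characteristic polynomial has real coefficients, so conjugation fixes it, and unique
    factorisation compares the roots with multiplicity. *)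
Lemma perm_eigs_conj (R : realType) (n : nat) (M : 'M[R]_n) :
  perm_eq [seq z^* | z <- codom (eigs M)]%R (codom (eigs M)).
Proof.
apply: prod_XsubC_eq.
have E : \prod_(z <- codom (eigs M)) ('X - z%:P) =
         char_poly (map_mx (fun r : R => (r%:C)%C) M).
  by rewrite eigs_spectrum codomE big_map big_enum.
have Mconj : map_poly (@Num.conj R[i]) (char_poly (map_mx (fun r : R => (r%:C)%C) M)) =
             char_poly (map_mx (fun r : R => (r%:C)%C) M).
  rewrite map_char_poly -map_mx_comp; congr char_poly.
  apply/matrixP => i j; rewrite !mxE /=.
  by apply/CrealP/complex_realP; exists (M i j).
rewrite E -Mconj -E rmorph_prod big_map; apply: eq_bigr => z _.
by rewrite rmorphB /= map_polyX map_polyC.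
Qed.

Lemma S_k_sub_skew_ge (R : realType) (n k : nat) (S K : 'M[R]_n) (a : R) :
  (k <= n)%N -> S^T = S -> K^T = - K -> 0 <= a ->
  (forall i, a <= complex.Re (eigs S i)) ->
  ((a ^+ k * 'C(n, k)%:R)%:C)%C <= S_k k (S - K).
Proof.
move=> kn hS hK a0 ha.
have Sreal : map_mx (fun r : R => (r%:C)%C) S \is a realmx.
  by apply/mxOverP => i j; rewrite mxE; apply/complex_realP; exists (S i j).
have Sherm : map_mx (fun r : R => (r%:C)%C) S \is hermsymmx.
  apply: realsym_hermsym => //; apply/is_hermitianmxP.
  by rewrite expr0 scale1r map_mx_id // map_trmx hS.
have aC : (0 : R[i]) <= (a%:C)%C by rewrite ler0c.
have evS z : eigenvalue (map_mx (fun r : R => (r%:C)%C) S) z -> (a%:C)%C <= z.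
  move=> zS; have zr := @hermsymmx_eigenvalue_real _ _ _ _ Sherm zS.
  have /eigenvalue_eigsP [i zE] := zS.
  by rewrite -(RRe_real zr) lecR zE.
have Re_ge z : z \in codom (eigs (S - K)) -> (a%:C)%C <= 'Re z.
  move=> /codomP[i zi].
  apply: (@eigenvalue_sub_skew_Re_ge _ _ _ (map_mx (fun r : R => (r%:C)%C) K) _ _ Sherm _ evS).
    rewrite map_trmx hK map_mxN raddfN; congr (- _); apply/matrixP => p q; rewrite !mxE.
    by apply/CrealP/complex_realP; exists (K p q).
  by rewrite -map_mxB; apply/eigenvalue_eigsP; exists i.
(* In degree [n - k] one side is [S_k k (S - K)]; on the other each of the ['C(n, k)] subsets
   contributes [a ^+ k]. *)
have /andP[_] := conj_closed_coef_ge _ _ _ aC (perm_eigs_conj _ _ (S - K)) Re_ge (n - k)%N.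
rewrite size_map -cardE card_ord codomE big_map big_enum coef_prod_XaddC //.
apply: le_trans.
have -> : ('X + ((a%:C)%C)%:P) ^+ n = \prod_(i < n) ('X + ((a%:C)%C)%:P) :> {poly R[i]}.
  by rewrite prodr_const card_ord.
rewrite coef_prod_XaddC // /sigma_k.
rewrite (eq_bigr (fun=> (a%:C)%C ^+ k)) => [|s /eqP <-]; last by rewrite prodr_const.
rewrite sumr_const -cardsE card_draws card_ord.
by rewrite rmorphM rmorphXn rmorph_nat mulr_natr.
Qed.

(** * Symmetry of mixed second derivatives *)

Lemma is_derive_line (R : realType) (V : normedModType R) (f : V -> R)
    (x v : V) (s d : R) :
  is_derive (s *: v + x) v f d -> is_derive s 1 (fun t : R => f (t *: v + x)) d.
Proof.
have E : (fun h : R => h^-1 *: ((f \o shift (s *: v + x)) (h *: v) - f (s *: v + x))) =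
         (fun h : R => h^-1 *: (((fun t : R => f (t *: v + x)) \o shift s) (h *: (1 : R))
                              - f (s *: v + x))).
  by apply/funext => h /=; rewrite [h *: 1]mulr1 scalerDl addrA.
move=> [df <-]; apply: DeriveDef; rewrite /derivable /derive /=.
  by rewrite -E.
by rewrite -E.
Qed.

(* The left-hand side is symmetric in v and w. *)
Lemma second_difference (R : realType) (V : normedModType R) (u du ddu : V -> R)
    (x v w : V) (h : R) :
  0 < h ->
  (forall s t, 0 <= s <= h -> 0 <= t <= h ->
     is_derive (s *: v + (t *: w + x)) v u (du (s *: v + (t *: w + x))) /\
     is_derive (s *: v + (t *: w + x)) w du (ddu (s *: v + (t *: w + x)))) ->
  exists s t, [/\ 0 <= s <= h, 0 <= t <= h &
    u (h *: v + (h *: w + x)) - u (h *: v + x) - (u (h *: w + x) - u x) =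
    h ^+ 2 * ddu (s *: v + (t *: w + x))].
Proof.
move=> h0 hd.
have hh : 0 <= h <= h by rewrite lexx ltW.
have h00 : (0 : R) <= 0 <= h by rewrite lexx ltW.
(* The second difference is [phi h - phi 0]: a mean value theorem along [v] produces [s], then one
   along [w] with [s] fixed produces [t]. *)
pose phi := (fun t : R => u (t *: v + (h *: w + x))) \- (fun t : R => u (t *: v + x)).
have dphi s : s \in `[0, h]%R ->
    is_derive s (1 : R) phi (du (s *: v + (h *: w + x)) - du (s *: v + x)).
  rewrite in_itv /= => sh.
  apply: is_deriveB; apply: is_derive_line.
    by case: (hd s h sh hh).
  by case: (hd s 0 sh h00); rewrite scale0r add0r.
have cphi : {within `[0, h], continuous phi}.
  by apply: derivable_within_continuous => s /dphi [].
have [s sh] := @MVT R phi _ 0 h h0 (fun s sh => dphi s (subset_itv_oo_cc sh)) cphi.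
rewrite /phi /= scale0r !add0r subr0 => ->.
have {}sh : 0 <= s <= h by move: sh; rewrite in_itv /= => /andP[? ?]; rewrite !ltW.
pose psi := fun t : R => du (t *: w + (s *: v + x)).
have dpsi t : t \in `[0, h]%R ->
    is_derive t (1 : R) psi (ddu (t *: w + (s *: v + x))).
  rewrite in_itv /= => th; apply: is_derive_line.
  by case: (hd s t sh th); rewrite addrCA.
have cpsi : {within `[0, h], continuous psi}.
  by apply: derivable_within_continuous => t /dpsi [].
have [t th] := @MVT R psi _ 0 h h0 (fun t th => dpsi t (subset_itv_oo_cc th)) cpsi.
rewrite /psi /= scale0r !add0r subr0 => E.
exists s, t; split => //.
  by move: th; rewrite in_itv /= => /andP[? ?]; rewrite !ltW.
by rewrite [s *: v + (h *: w + x)]addrCA E [s *: v + (t *: w + x)]addrCA expr2; ring.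
Qed.

(** One second difference equals [h ^+ 2] times [dvw] at one nearby point and times [dwv] at
    another; continuity at [x] brings both values within [e / 2]. *)
Lemma mixed_derivative_sym (R : realType) (V : normedModType R)
    (u dv dw dvw dwv : V -> R) (x v w : V) :
  (\forall y \near x, [/\ is_derive y v u (dv y), is_derive y w u (dw y),
     is_derive y w dv (dvw y) & is_derive y v dw (dwv y)]) ->
  {for x, continuous dvw} -> {for x, continuous dwv} ->
  dvw x = dwv x.
Proof.
move=> hd cvw cwv; apply/eqP; rewrite -subr_eq0 -normr_le0; apply/ler_addgt0Pr => e e0.
rewrite add0r.
have e2 : 0 < e / 2 by rewrite divr_gt0.
have : \forall y \near x, [/\ [/\ is_derive y v u (dv y), is_derive y w u (dw y),
     is_derive y w dv (dvw y) & is_derive y v dw (dwv y)],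
     `|dvw x - dvw y| < e / 2 & `|dwv x - dwv y| < e / 2].
  near=> y; split; near: y => //.
    by move/cvgrPdist_lt : cvw; exact.
  by move/cvgrPdist_lt : cwv; exact.
move=> /nbhs_normP[r /= r0 xr].
(* This size keeps the parallelogram spanned by [h *: v] and [h *: w] at [x] inside the ball of
   radius [r]; the [1] makes the inclusion strict and allows [v = w = 0]. *)
pose h := r / (`|v| + `|w| + 1).
have D0 : 0 < `|v| + `|w| + 1 by rewrite ltr_wpDl ?addr_ge0.
have h0 : 0 < h by rewrite divr_gt0.
have near_x s t : 0 <= s <= h -> 0 <= t <= h -> ball_ Num.norm x r (s *: v + (t *: w + x)).
  move=> /andP[s0 sh] /andP[t0 th]; rewrite /ball_ /= addrA opprD addrCA subrr addr0 normrN.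
  apply: (le_lt_trans (ler_normD _ _)); rewrite !normrZ !ger0_norm //.
  apply: (@le_lt_trans _ _ (h * (`|v| + `|w|))).
    by rewrite mulrDr lerD // ler_wpM2r.
  by rewrite /h mulrAC ltr_pdivrMr // ltr_pM2l // ltrDl.
have [|s [t [sh th E1]]] := @second_difference _ _ u dv dvw x v w h h0.
  by move=> s t sh th; have [[]] := xr _ (near_x s t sh th).
have [|t' [s' [th' sh' E2]]] := @second_difference _ _ u dw dwv x w v h h0.
  by move=> t' s' th' sh'; rewrite addrCA; have [[]] := xr _ (near_x _ _ sh' th').
have E : dvw (s *: v + (t *: w + x)) = dwv (s' *: v + (t' *: w + x)).
  apply: (@mulfI _ (h ^+ 2)); first by rewrite expf_eq0 /= gt_eqF.
  by rewrite -E1 [s' *: v + _]addrCA -E2 [h *: w + (h *: v + x)]addrCA; ring.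
have [_ + _] := xr _ (near_x s t sh th); rewrite E => l1.
have [_ _ l2] := xr _ (near_x s' t' sh' th').
rewrite [e]splitr; apply: (le_trans (ler_distD (dwv (s' *: v + (t' *: w + x))) _ _)).
by apply: lerD; apply: ltW => //; rewrite distrC.
Unshelve. all: by end_near. Qed.

(** * Compactness, and suprema and infima that are genuine bounds *)

Lemma ler_norm_enorm (R : realType) (n : nat) (v : 'rV[R]_n) : `|v| <= enorm v.
Proof.
(* The built-in norm on row vectors is the maximum norm, in which the compactness argument below is
   carried out. *)
rewrite [leLHS]/Num.norm /= mx_normrE; apply/bigmax_leP; split; first exact: sqrtr_ge0.
move=> [i j] _ /=; rewrite (ord1 i) -sqrtr_sqr /enorm ler_wsqrtr //.
by rewrite (bigD1 j) //= lerDl sumr_ge0 // => k _; exact: sqr_ge0.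
Qed.

(** [sup] bounds a set only if the set is bounded above. The constraint set lies in a compact
    product whose last factor is a maximum-norm ball, which contains the Euclidean one. *)
Lemma f1_ub (R : realType) (n : nat) (Om : set 'rV[R]_n)
    (f : 'rV[R]_n -> R -> 'rV[R]_n -> R) (M0 M1 : R) (x p : 'rV[R]_n) (z : R) :
  (exists r : R, forall x, Om x -> enorm x <= r) ->
  {within [set q : 'rV[R]_n * R * 'rV[R]_n | inD Om q.1.1 q.1.2 q.2],
     continuous (fun q : 'rV[R]_n * R * 'rV[R]_n => f q.1.1 q.1.2 q.2)} ->
  closure Om x -> `|z| <= M0 -> enorm p <= M1 -> f x z p <= f1 Om f M0 M1.
Proof.
move=> [r Omr] fcont xOm zM pM; apply: ub_le_sup; last by exists (x, z, p).
have ball_closed (M : R) : closed [set v : 'rV[R]_n | `|v| <= M].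
  apply: (@closed_comp _ _ (fun v : 'rV[R]_n => `|v|) [set y : R | y <= M]).
    by move=> y _; exact: norm_continuous.
  exact: closed_le.
have ball_compact (M : R) : compact [set v : 'rV[R]_n | `|v| <= M].
  apply: bounded_closed_compact (ball_closed M).
  exists M; split; first exact: num_real.
  by move=> M' MM' y /= /le_trans; apply; exact: ltW.
have Omc : compact (closure Om).
  apply: (subclosed_compact (@closed_closure _ Om) (ball_compact r)).
  rewrite closureE => y; apply; split; first exact: ball_closed.
  by move=> w /Omr; apply: le_trans; exact: ler_norm_enorm.
have Kc : compact ((closure Om `*` `[- M0, M0]) `*` [set v : 'rV[R]_n | `|v| <= M1]).
  by do 2 apply: compact_setX => //; exact: segment_compact.
have fK : {within ((closure Om `*` `[- M0, M0]) `*` [set v : 'rV[R]_n | `|v| <= M1]),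
    continuous (fun q : 'rV[R]_n * R * 'rV[R]_n => f q.1.1 q.1.2 q.2)}.
  by apply: continuous_subspaceW fcont => -[[a b] c] [[]].
have /compact_bounded[M [_ MP]] := continuous_compact fK Kc.
exists (M + 1) => _ [[[a b] c] /= [aO bM cM] <-].
apply: le_trans (ler_norm _) _; apply: (MP (M + 1)); first by rewrite ltrDl.
exists (a, b, c) => //=; split => /=; first split => //=.
  by rewrite in_itv /= -ler_norml.
by apply: le_trans cM; exact: ler_norm_enorm.
Qed.

Lemma lambda_min_le (R : realType) (n : nat) (M : 'M[R]_n) (i : 'I_n) :
  lambda_min M <= complex.Re (eigs M i).
Proof.
apply: ge_inf; last by exists i.
(* A crude lower bound, showing that this [inf] is not a default value. *)
exists (- \sum_j `|complex.Re (eigs M j)|) => _ [j _ <-].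
rewrite lerNl (le_trans (ler_norm _)) // normrN (bigD1 j) //= lerDl.
by rewrite sumr_ge0.
Qed.

(** * The estimate at a point of [Om], followed by a [k]-th root *)

Theorem theorem1p12 (R : realType) (n k : nat) (Om : set 'rV[R]_n)
  (A B : 'rV[R]_n -> R -> 'rV[R]_n -> 'M[R]_n)
  (f : 'rV[R]_n -> R -> 'rV[R]_n -> R) (delta M0 M1 : R)
  (u : 'rV[R]_n -> R) (Du : 'rV[R]_n -> 'rV[R]_n) (D2u : 'rV[R]_n -> 'M[R]_n) :
  (2 <= k)%N -> (k <= n)%N ->
  open Om ->
  (exists r : R, forall x, Om x -> enorm x <= r) ->
  (forall x z p, inD Om x z p -> (A x z p)^T = A x z p) ->
  (forall x z p, inD Om x z p -> (B x z p)^T = - B x z p) ->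
  (exists c : R, forall x z p, inD Om x z p -> opnorm (B x z p) <= c) ->
  {within [set q : 'rV[R]_n * R * 'rV[R]_n | inD Om q.1.1 q.1.2 q.2],
     continuous (fun q : 'rV[R]_n * R * 'rV[R]_n => f q.1.1 q.1.2 q.2)} ->
  0 < delta < 1 ->
  C2_closure Om u Du D2u ->
  (forall x, closure Om x ->
     S_k k (D2u x - A x (u x) (Du x) - B x (u x) (Du x))
       = ((f x (u x) (Du x))%:C)%C) ->
  0 < lambda_u Om A u Du D2u ->
  mu Om B <= delta * lambda_u Om A u Du D2u ->
  (forall x, closure Om x -> `|u x| <= M0) ->
  (forall x, closure Om x -> enorm (Du x) <= M1) ->
  mu Om B <= delta * powR (f1 Om f M0 M1 / ('C(n, k))%:R) (k%:R^-1).
Proof.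
move=> k2 kn Omo Ombd Asym Bskew _ fcont /andP[delta0 _] uC2 ueq lam0 mulam uM DuM.
apply: (le_trans mulam); rewrite ler_pM2l //.
set a := lambda_u Om A u Du D2u in lam0 *.
(* Here inf = 0 on sets that are empty or unbounded below, which lam0 excludes. *)
have [Ene Elb] : has_inf [set lambda_min (D2u x - A x (u x) (Du x)) | x in closure Om].
  by apply: contraPP lam0 => /inf_out; rewrite /a /lambda_u => ->; rewrite ltxx.
(* Derivatives are given only in [Om], so a point of [Om] itself is required: the whole space is a
   neighbourhood of a closure point and hence meets [Om]. *)
have [x Omx] : Om !=set0.
  have [_ [y Omy _]] := Ene; have [z [Omz _]] := Omy setT filterT.
  by exists z.
have Ocx := subset_closure Omx.
(* Continuity of [D2u] on the closure gives continuity at [x] because [Om] is open, so the mixed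
   partials agree there. *)
have D2usym : (D2u x)^T = D2u x.
  case: uC2 => du ddu _ _ cD2; apply/matrixP => i j; rewrite mxE.
  have entry_cont p q : {for x, continuous (fun y => D2u y p q)}.
    have cx : {for x, continuous D2u}.
      have := continuous_subspaceW (@subset_closure _ Om) cD2.
      by rewrite continuous_open_subspace // => /(_ x (mem_set Omx)).
    apply: (@continuous_comp _ _ _ D2u (fun M : 'M[R]_n => M p q)) => //.
    exact: coord_continuous.
  apply: (@mixed_derivative_sym _ _ u (fun y => Du y ord0 j) (fun y => Du y ord0 i)
      (fun y => D2u y j i) (fun y => D2u y i j) x (delta_mx ord0 j) (delta_mx ord0 i)) => //.
  near=> y; have Omy : Om y by near: y; exact: open_nbhs_nbhs.
  by split; [exact: du|exact: du|exact: ddu|exact: ddu].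
have : ((a ^+ k * 'C(n, k)%:R)%:C)%C <=
    S_k k (D2u x - A x (u x) (Du x) - B x (u x) (Du x)).
  apply: S_k_sub_skew_ge => //.
  - by rewrite linearB /= D2usym Asym.
  - by rewrite Bskew.
  - exact: ltW.
  - move=> i; apply: le_trans (lambda_min_le _ _ _ i).
    by apply: ge_inf => //; exists x.
rewrite ueq // lecR => af.
have C0 : 0 < 'C(n, k)%:R :> R by rewrite ltr0n bin_gt0.
have k0 : k%:R != 0 :> R by rewrite pnatr_eq0; case: k k2 {kn ueq af C0}.
have {}af : a ^+ k <= f1 Om f M0 M1 / 'C(n, k)%:R.
  rewrite ler_pdivlMr //; apply: (le_trans af); apply: f1_ub => //.
    exact: uM.
  exact: DuM.
(* Since [0 < a] and [k != 0], [a] is the [k]-th root of [a ^+ k], and [k]-th roots are monotone on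
   nonnegative reals. *)
rewrite -[leLHS](_ : powR (a ^+ k) k%:R^-1 = a).
  apply: ge0_ler_powR; rewrite ?invr_ge0 ?nnegrE //.
    by rewrite exprn_ge0 ?ltW.
  by apply: le_trans af; rewrite exprn_ge0 ?ltW.
by rewrite -powR_mulrn ?ltW // -powRrM mulfV // powRr1 ?ltW.
Unshelve. all: by end_near. Qed.
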